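(* Assume that $T$, or just $T^P$, eliminates imaginaries. Then for a set $A\subseteq\mathcal C$ the following are equivalent: (i) $A$ is complete; (ii) $P^A\prec P^{\mathcal C}$ and $\mathrm{dcl}(A)\cap P^{\mathcal C}=P^A$; (iii) $P^A\prec P^{\mathcal C}$ and $\mathrm{acl}(A)\cap P^{\mathcal C}=P^A$.
   Context: Setting: $T$ is a complete first-order theory whose language contains a distinguished unary predicate $P$ and no function symbols (every subset is treated as a substructure), and $T$ implies $P$ is infinite. $\mathcal C$ is a monster model of $T$. For a set $A$, $P^A=A\cap P^{\mathcal C}$; $\mathcal C^P$ is the substructure with universe $P^{\mathcal C}$, $T^P=\mathrm{Th}(\mathcal C^P)$, and $P^A\prec P^{\mathcal C}$ means $P^A$ is an elementary substructure of $\mathcal C^P$. Standing hypotheses: (1) every subset of $P^{\mathcal C}$ definable in $\mathcal C$ with parameters is definable with parameters from $P^{\mathcal C}$; (2) every subset of $P^{\mathcal C}$ that is $0$-definable in $\mathcal C$ is $0$-definable in $\mathcal C^P$; (3) $T$ has quantifier elimination. A set $A$ is complete if for every formula $\psi(\bar x,\bar y)$ and $\bar b\subseteq A$, if $\models(\exists \bar x\in P)\psi(\bar x,\bar b)$ then there is $\bar a\subseteq P\cap A$ with $\models\psi(\bar a,\bar b)$. Elimination of imaginaries: every definable set has a code (a tuple $c$ which is the unique tuple with $X=\varphi(\mathcal C,c)$ for some formula $\varphi$).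
   Formalization: Only ''T^P eliminates imaginaries'' is assumed: elimination of imaginaries for T alone does not give it for T^P, and the equivalence can then fail (e.g. P a linear order mapped monotonically onto a dense order Q outside P, with dense fibres coded only in Q). *)

(* Defs.v *)
From mathcomp Require Import all_boot.
From mathcomp Require Import boolp classical_sets cardinality.

Set Implicit Arguments.
Unset Strict Implicit.
Unset Printing Implicit Defensive.

Local Open Scope classical_set_scope.
Local Open Scope card_scope.

(* Relational first-order languages with a distinguished unary predicate. *)
Record language : Type := Language {
  other_symbol : Type;
  other_arity : other_symbol -> nat }.

(* [None] is the distinguished unary predicate P. *)
Definition symbol (L : language) : Type := option (other_symbol L).

Definition arity (L : language) (r : symbol L) : nat :=
  if r is Some s then other_arity s else 1.

(* [formula L n]: formulas whose free variables are among v_0, ..., v_(n-1).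
   [All] binds variable 0 of its body and shifts the others by one. *)
Inductive formula (L : language) : nat -> Type :=
| Rel n (r : symbol L) (v : (arity r).-tuple 'I_n) : formula L n
| Eq n (i j : 'I_n) : formula L n
| Bot n : formula L n
| Imp n (phi psi : formula L n) : formula L n
| All n (phi : formula L n.+1) : formula L n.

Arguments Bot {L n}.

Fixpoint quantifier_free L n (phi : formula L n) : Prop :=
  match phi with
  | Rel _ _ _ | Eq _ _ _ | Bot _ => True
  | Imp _ phi1 phi2 => quantifier_free phi1 /\ quantifier_free phi2
  | All _ _ => False
  end.

Record structure (L : language) : Type := Structure {
  carrier :> Type;
  interp : forall r : symbol L, set ((arity r).-tuple carrier) }.

Fixpoint sat L (M : structure L) n (phi : formula L n) : n.-tuple M -> Prop :=
  match phi with
  | Rel _ r v => fun e => interp (map_tuple (tnth e) v)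
  | Eq _ i j => fun e => tnth e i = tnth e j
  | Bot _ => fun _ => False
  | Imp _ phi1 phi2 => fun e => sat phi1 e -> sat phi2 e
  | All _ phi1 => fun e => forall a : M, sat phi1 (cons_tuple a e)
  end.

Definition tuple_in T (A : set T) n (a : n.-tuple T) : Prop :=
  forall i, A (tnth a i).

Definition Pset L (M : structure L) : set M :=
  fun a => @interp L M None [tuple a].

(** Substructures *)

(* As there are no function symbols, every subset carries a substructure. *)
Definition substructure L (M : structure L) (A : set M) : structure L :=
  {| carrier := A; interp := fun r a => interp (map_tuple val a) |}.

Definition elementary L (M : structure L) (A : set M) : Prop :=
  forall n (phi : formula L n) (a : n.-tuple (substructure A)),
    sat phi a <-> @sat L M n phi (map_tuple val a).

(* The structure M^P with universe P^M. *)
Definition Ppart L (M : structure L) : structure L := substructure (@Pset L M).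

(* P^A = A `&` P^M, seen as a subset of M^P. *)
Definition Ptrace L (M : structure L) (A : set M) : set (Ppart M) :=
  fun a => A (val a).

(** Theories *)

Definition sentence (L : language) : Type := formula L 0.

Definition theory (L : language) : Type := set (sentence L).

Definition holds L (M : structure L) (s : sentence L) : Prop :=
  sat s [tuple of nil : seq M].

Definition models L (M : structure L) (T : theory L) : Prop :=
  forall s, T s -> holds M s.

Definition complete_theory L (T : theory L) : Prop :=
  (exists M : structure L, models M T) /\
  forall s : sentence L,
    (forall M : structure L, models M T -> holds M s) \/
    (forall M : structure L, models M T -> holds M (Imp s Bot)).

Definition implies_P_infinite L (T : theory L) : Prop :=
  forall M : structure L, models M T -> infinite_set (@Pset L M).

Definition quantifier_elimination L (T : theory L) : Prop :=
  forall n (phi : formula L n), exists psi : formula L n,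
    quantifier_free psi /\
    forall M : structure L, models M T ->
      forall a : n.-tuple M, sat phi a <-> sat psi a.

(** Definable sets *)

Definition definable L (M : structure L) (A : set M) n (X : set (n.-tuple M))
    : Prop :=
  exists m (phi : formula L (n + m)) (b : m.-tuple M),
    tuple_in A b /\ X = [set x : n.-tuple M | sat phi (cat_tuple x b)].

Definition dcl L (M : structure L) (A : set M) : set M :=
  fun c => definable A [set [tuple c]].

Definition acl L (M : structure L) (A : set M) : set M :=
  fun c => exists X : set (1.-tuple M),
    [/\ definable A X, finite_set X & X [tuple c]].

(* A theory eliminates imaginaries when this holds in its monster model; for
   T^P = Th(C^P) that model is [Ppart C].
   The length k of a code may be 0, and codes are tuples of elements of M.
   Hence, for a monster model C, the property of C does not imply that of
   [Ppart C]: a definable subset of P^C may have its codes outside of P^C.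
   For instance, let Q be a dense linear order without endpoints, let P be a
   linear order with a monotone surjection P -> Q whose fibres are dense and
   without endpoints, and let C be the disjoint union of P and Q, with both
   orders and (the graph of) the surjection. Every definable set of C has a
   code, but the fibres have no code in P^C. *)
Definition eliminates_imaginaries L (M : structure L) : Prop :=
  forall n (X : set (n.-tuple M)), definable setT X ->
    exists k (phi : formula L (n + k)) (c : k.-tuple M),
      forall c' : k.-tuple M,
        X = [set x : n.-tuple M | sat phi (cat_tuple x c')] <-> c' = c.

(** Monster models *)

Definition card_lt T U (A : set T) (B : set U) : Prop :=
  A #<= B /\ ~ (B #<= A).

(* A formula in one variable with parameters in M. *)
Definition pformula L (M : structure L) : Type :=
  {m : nat & (formula L (1 + m) * m.-tuple M)%type}.

Definition pformula_over L (M : structure L) (A : set M) : set (pformula M) :=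
  fun f => tuple_in A (projT2 f).2.

Definition psat L (M : structure L) (f : pformula M) (a : M) : Prop :=
  sat (projT2 f).1 (cat_tuple [tuple a] (projT2 f).2).

(* Cardinals are represented by types: here kappa = |K|. *)
Definition saturated L (K : Type) (M : structure L) : Prop :=
  forall A : set M, card_lt A [set: K] ->
  forall p : set (pformula M), p `<=` pformula_over A ->
    (forall q : set (pformula M), finite_set q -> q `<=` p ->
       exists a : M, forall f, q f -> psat f a) ->
    exists a : M, forall f, p f -> psat f a.

Definition elementary_on L (M : structure L) (A : set M) (f : M -> M) : Prop :=
  forall n (phi : formula L n) (a : n.-tuple M), tuple_in A a ->
    (sat phi a <-> sat phi (map_tuple f a)).

Definition automorphism L (M : structure L) (g : M -> M) : Prop :=
  bijective g /\
  forall (r : symbol L) (a : (arity r).-tuple M),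
    interp a <-> interp (map_tuple g a).

Definition strongly_homogeneous L (K : Type) (M : structure L) : Prop :=
  forall A : set M, card_lt A [set: K] ->
  forall f : M -> M, elementary_on A f ->
    exists g : M -> M, automorphism g /\ forall a, A a -> g a = f a.

Definition monster_model L (K : Type) (T : theory L) (C : structure L) : Prop :=
  [/\ card_lt [set: nat] [set: K],
      card_lt [set: symbol L] [set: K],
      models C T,
      saturated K C
    & strongly_homogeneous K C].

(** Standing hypotheses on P *)

(* Subsets of P^C are meant in all finite Cartesian powers. *)
Definition P_stably_embedded L (C : structure L) : Prop :=
  forall n (X : set (n.-tuple C)), X `<=` tuple_in (@Pset L C) (n := n) ->
    definable setT X -> definable (@Pset L C) X.

Definition P_zero_definable L (C : structure L) : Prop :=
  forall n (X : set (n.-tuple C)), X `<=` tuple_in (@Pset L C) (n := n) ->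
    definable set0 X ->
    definable set0 [set y : n.-tuple (Ppart C) | X (map_tuple val y)].

(** Complete sets *)

Definition complete_set L (C : structure L) (A : set C) : Prop :=
  forall n m (psi : formula L (n + m)) (b : m.-tuple C), tuple_in A b ->
    (exists x : n.-tuple C,
       tuple_in (@Pset L C) x /\ sat psi (cat_tuple x b)) ->
    exists a : n.-tuple C,
      tuple_in (@Pset L C `&` A) a /\ sat psi (cat_tuple a b).

(* Main.v *)
(* If A is complete, the Tarski-Vaught test gives elementarity, and a finite set
   X definable over A has all its points of P in A: otherwise the condition
   "x is in X but is none of the finitely many points of X in P^A" would be
   realized in P, hence in P^A.
   Conversely, let X = psi(P,b) be nonempty with b in A. By stable embeddedness
   X is definable in C^P, so it has a code c in P, say X = phi(C^P,c). As c is
   determined by X, it lies in dcl(A), hence in P^A; now "exists x, phi(x,c)"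
   passes from C^P down to P^A, and a witness there is a point of X. *)
Require Import Defs.
From mathcomp Require Import all_boot.
From mathcomp Require Import boolp classical_sets cardinality.

Local Open Scope classical_set_scope.

Set Implicit Arguments.
Unset Strict Implicit.
Unset Printing Implicit Defensive.

(** * Tuples with entries in a subset, and finite sets listed by tuples *)

Section Tuples.
Variables (T : Type).

Lemma tnth_cons0 n (a : T) (e : n.-tuple T) : tnth (cons_tuple a e) ord0 = a.
Proof. by rewrite (tnth_nth a). Qed.

Lemma tnth_consS n (a : T) (e : n.-tuple T) i :
  tnth (cons_tuple a e) (lift ord0 i) = tnth e i.
Proof. by rewrite !(tnth_nth a). Qed.

Lemma tuple1E (x : 1.-tuple T) : x = [tuple tnth x ord0].
Proof. by apply: eq_from_tnth => i; rewrite (ord1 i). Qed.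

Lemma map_cat_tuple U (f : T -> U) n m (x : n.-tuple T) (y : m.-tuple T) :
  map_tuple f (cat_tuple x y) = cat_tuple (map_tuple f x) (map_tuple f y).
Proof. by apply: val_inj; rewrite /= map_cat. Qed.

Lemma map_cons_tuple U (f : T -> U) n (a : T) (x : n.-tuple T) :
  map_tuple f (cons_tuple a x) = cons_tuple (f a) (map_tuple f x).
Proof. exact: val_inj. Qed.

Lemma tuple_in_cat (A : set T) n m (x : n.-tuple T) (y : m.-tuple T) :
  tuple_in A x -> tuple_in A y -> tuple_in A (cat_tuple x y).
Proof.
move=> Ax Ay i; rewrite -[i]splitK; case: (fintype.split i) => j /=.
  by rewrite tnth_lshift.
by rewrite tnth_rshift.
Qed.

Lemma tuple_in_map_val (A : set T) n (y : n.-tuple A) :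
  tuple_in A (map_tuple val y).
Proof. by move=> i; rewrite tnth_map; exact/set_mem/valP. Qed.

Lemma tuple_in_lift (A : set T) n (x : n.-tuple T) :
  tuple_in A x -> exists y : n.-tuple A, x = map_tuple val y.
Proof.
move=> Ax.
exists [tuple (exist _ (tnth x i) (mem_set (Ax i)) : A) | i < n].
by apply: eq_from_tnth => i; rewrite tnth_map tnth_mktuple.
Qed.

(** Listing a finite set as a tuple lets its elements enter a formula as parameters. *)
Lemma finite_set_tuple (S : set T) : finite_set S ->
  exists k (d : k.-tuple T), forall x, S x <-> exists i, x = tnth d i.
Proof.
(* [{classic T}] is [T] with the decidable equality that membership in a sequence asks for. *)
move=> /(finite_seqP (T := {classic T}))[s ->].
by exists (size s), (in_tuple s) => x; split=> /(tnthP (in_tuple s) x).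
Qed.

End Tuples.

(** * Renaming of variables, relativization to P, blocks of quantifiers *)

Section Syntax.
Variable L : language.

Definition lift_var n m (f : 'I_n -> 'I_m) (i : 'I_n.+1) : 'I_m.+1 :=
  if unlift ord0 i is Some j then lift ord0 (f j) else ord0.

Fixpoint rename n (phi : formula L n) m : ('I_n -> 'I_m) -> formula L m :=
  match phi with
  | Rel _ r v => fun f => Rel (map_tuple f v)
  | Eq _ i j => fun f => Eq L (f i) (f j)
  | Bot _ => fun _ => Bot
  | Imp _ phi1 phi2 => fun f => Imp (rename phi1 f) (rename phi2 f)
  | All _ phi1 => fun f => All (rename phi1 (lift_var f))
  end.

Definition InP n (i : 'I_n) : formula L n := @Rel L n None [tuple i].

(** Bounding every quantifier by P turns truth in [Ppart M] into truth in [M]. This is how codes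
    found in C^P are spoken about in C. *)
Fixpoint relativize n (phi : formula L n) : formula L n :=
  match phi with
  | Rel _ r v => Rel v
  | Eq _ i j => Eq L i j
  | Bot _ => Bot
  | Imp _ phi1 phi2 => Imp (relativize phi1) (relativize phi2)
  | All _ phi1 => All (Imp (InP ord0) (relativize phi1))
  end.

(** The innermost quantifier binds variable 0, so the quantified block occupies the first [k]
    coordinates, before the remaining [n]. *)
Fixpoint Alls k n : formula L (k + n) -> formula L n :=
  if k is k'.+1 then fun phi => Alls (All phi) else id.

Variable M : structure L.

Lemma sat_rename n (phi : formula L n) m (f : 'I_n -> 'I_m) (e : m.-tuple M)
    (e' : n.-tuple M) :
  (forall i, tnth e' i = tnth e (f i)) -> sat (rename phi f) e <-> sat phi e'.
Proof.
elim: phi m f e e' => {n} [n r v|n i j|n|n p IHp q IHq|n p IHp] m f e e' ee' /=.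
- suff -> : map_tuple (tnth e) (map_tuple f v) = map_tuple (tnth e') v by [].
  by apply: eq_from_tnth => i; rewrite !tnth_map ee'.
- by rewrite !ee'.
- by [].
- by rewrite (IHp _ _ _ _ ee') (IHq _ _ _ _ ee').
- have IH a := IHp _ (lift_var f) (cons_tuple a e) (cons_tuple a e').
  suff ee'' a i : tnth (cons_tuple a e') i = tnth (cons_tuple a e) (lift_var f i).
    by split=> H a; have /(IH a) := ee'' a; move: (H a) => Ha IHa; apply/IHa.
  rewrite /lift_var; case: unliftP => [j|] ->; last by rewrite !tnth_cons0.
  by rewrite !tnth_consS.
Qed.

Lemma sat_InP n (i : 'I_n) (e : n.-tuple M) : sat (InP i) e = Pset (tnth e i).
Proof.
rewrite /= /Pset; congr (interp _).
by apply: eq_from_tnth => j; rewrite tnth_map (ord1 j).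
Qed.

Lemma sat_relativize n (phi : formula L n) (e : n.-tuple (Ppart M)) :
  @sat L M n (relativize phi) (map_tuple val e) <-> sat phi e.
Proof.
elim: phi e => {n} [n r v|n i j|n|n p IHp q IHq|n p IHp] e.
- rewrite /=.
  suff -> : map_tuple (tnth (map_tuple val e)) v =
            map_tuple val (map_tuple (tnth e) v) by [].
  by apply: eq_from_tnth => i; rewrite !tnth_map.
- by rewrite /= !tnth_map; split=> [/val_inj|->].
- by [].
- by rewrite /= IHp IHq.
- have PE a : sat (InP ord0) (cons_tuple a (map_tuple val e)) = Pset a.
    by rewrite sat_InP tnth_cons0.
  split=> H a.
    have Pa : sat (InP ord0) (cons_tuple (val a) (map_tuple val e)).
      by rewrite PE; exact/set_mem/valP.
    by apply/IHp; rewrite map_cons_tuple; exact: H Pa.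
  change (sat (InP ord0) (cons_tuple a (map_tuple val e)) ->
    sat (relativize p) (cons_tuple a (map_tuple val e))).
  rewrite PE => Pa.
  have /IHp := H (exist _ a (mem_set Pa)).
  by rewrite map_cons_tuple.
Qed.

Lemma sat_Alls k n (phi : formula L (k + n)) (e : n.-tuple M) :
  sat (Alls phi) e <-> forall x : k.-tuple M, sat phi (cat_tuple x e).
Proof.
elim: k phi => [|k IHk] phi.
  have cat0 (x : 0.-tuple M) : cat_tuple x e = (e : (0 + n).-tuple M).
    by apply: val_inj; rewrite tuple0.
  by split=> [H x|/(_ [tuple])]; rewrite cat0.
have catS a (x : k.-tuple M) :
    cat_tuple (cons_tuple a x) e = cons_tuple a (cat_tuple x e) by exact: val_inj.
rewrite /= IHk; split=> H x.
  by case/tupleP: x => a x; rewrite (catS a x); exact: H.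
by move=> a; rewrite -(catS a x); exact: H.
Qed.

End Syntax.

(** * Closure properties of 0-definable conditions, used to avoid writing formulas by hand *)

Section ZeroDefinable.
Variables (L : language) (M : structure L).

(* Unlike [definable set0], there is no empty tuple of parameters to carry. *)
Definition zdef n (X : n.-tuple M -> Prop) : Prop :=
  exists phi : formula L n, forall e, sat phi e <-> X e.

(** [f] is chosen independently of [e]: such a [t] only selects, repeats or permutes coordinates,
    and composing a formula with [t] amounts to renaming its variables. *)
Definition projection n m (t : n.-tuple M -> m.-tuple M) : Prop :=
  exists f : 'I_m -> 'I_n, forall e i, tnth (t e) i = tnth e (f i).

Definition lproj n m (e : (n + m).-tuple M) : n.-tuple M :=
  [tuple tnth e (lshift m i) | i < n].

Definition rproj n m (e : (n + m).-tuple M) : m.-tuple M :=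
  [tuple tnth e (rshift n i) | i < m].

Lemma lproj_cat n m (x : n.-tuple M) (y : m.-tuple M) :
  lproj (cat_tuple x y) = x.
Proof. by apply: eq_from_tnth => i; rewrite tnth_mktuple tnth_lshift. Qed.

Lemma rproj_cat n m (x : n.-tuple M) (y : m.-tuple M) :
  rproj (cat_tuple x y) = y.
Proof. by apply: eq_from_tnth => i; rewrite tnth_mktuple tnth_rshift. Qed.

Lemma projection_id n : projection (fun e : n.-tuple M => e).
Proof. by exists id. Qed.

Lemma projection_l n m l (t : l.-tuple M -> (n + m).-tuple M) :
  projection t -> projection (fun e => lproj (t e)).
Proof.
by case=> f tf; exists (f \o lshift m) => e i; rewrite tnth_mktuple tf.
Qed.

Lemma projection_r n m l (t : l.-tuple M -> (n + m).-tuple M) :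
  projection t -> projection (fun e => rproj (t e)).
Proof.
by case=> f tf; exists (f \o @rshift n m) => e i; rewrite tnth_mktuple tf.
Qed.

Lemma projection_cat l n m (t : l.-tuple M -> n.-tuple M)
    (u : l.-tuple M -> m.-tuple M) :
  projection t -> projection u -> projection (fun e => cat_tuple (t e) (u e)).
Proof.
move=> [f tf] [g ug].
exists (fun i => match fintype.split i with inl j => f j | inr j => g j end).
move=> e i; rewrite -{1}[i]splitK; case: (fintype.split i) => j /=.
  by rewrite tnth_lshift.
by rewrite tnth_rshift.
Qed.

Lemma zdef_sat l n (phi : formula L n) (t : l.-tuple M -> n.-tuple M) :
  projection t -> zdef (fun e => sat phi (t e)).
Proof.
by case=> f tf; exists (rename phi f) => e; exact: sat_rename.
Qed.

Lemma zdef_eq l n m (t : l.-tuple M -> n.-tuple M) (u : l.-tuple M -> m.-tuple M)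
    i j :
  projection t -> projection u -> zdef (fun e => tnth (t e) i = tnth (u e) j).
Proof.
by move=> [f tf] [g ug]; exists (Eq L (f i) (g j)) => e; rewrite /= tf ug.
Qed.

Lemma zdef_imp n (X Y : n.-tuple M -> Prop) :
  zdef X -> zdef Y -> zdef (fun e => X e -> Y e).
Proof.
by move=> [p pX] [q qY]; exists (Imp p q) => e; rewrite /= pX qY.
Qed.

Lemma zdef_not n (X : n.-tuple M -> Prop) : zdef X -> zdef (fun e => ~ X e).
Proof. by move=> hX; apply: zdef_imp => //; exists Bot. Qed.

Lemma zdef_ext n (X Y : n.-tuple M -> Prop) :
  (forall e, X e <-> Y e) -> zdef X -> zdef Y.
Proof. by move=> XY [p pX]; exists p => e; rewrite pX. Qed.

Lemma zdef_and n (X Y : n.-tuple M -> Prop) :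
  zdef X -> zdef Y -> zdef (fun e => X e /\ Y e).
Proof.
move=> hX hY.
apply: zdef_ext (zdef_not (zdef_imp hX (zdef_not hY))) => e.
by rewrite not_implyE not_notE.
Qed.

Lemma zdef_iff n (X Y : n.-tuple M -> Prop) :
  zdef X -> zdef Y -> zdef (fun e => X e <-> Y e).
Proof. by move=> hX hY; apply: zdef_and; apply: zdef_imp. Qed.

Lemma zdef_forall k n (X : k.-tuple M -> n.-tuple M -> Prop) :
  zdef (fun e : (k + n).-tuple M => X (lproj e) (rproj e)) ->
  zdef (fun e => forall x, X x e).
Proof.
move=> [p pX]; exists (Alls p) => e; rewrite sat_Alls.
by split=> H x; have := H x; rewrite pX lproj_cat rproj_cat.
Qed.

Lemma zdef_exists k n (X : k.-tuple M -> n.-tuple M -> Prop) :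
  zdef (fun e : (k + n).-tuple M => X (lproj e) (rproj e)) ->
  zdef (fun e => exists x, X x e).
Proof.
move=> /zdef_not hX.
apply: zdef_ext (zdef_not (zdef_forall (X := fun x e => ~ X x e) hX)) => e.
by rewrite -not_existsP.
Qed.

(** A quantifier over a finite index type lies outside the language, so it is unfolded into a
    conjunction along [enum I], with [Imp Bot Bot] as the empty conjunction. *)
Lemma zdef_all n (I : finType) (X : I -> n.-tuple M -> Prop) :
  (forall i, zdef (X i)) -> zdef (fun e => forall i, X i e).
Proof.
move=> hX.
suff : zdef (fun e => forall i, i \in enum I -> X i e).
  by apply: zdef_ext => e; split=> H i; [apply: H; rewrite mem_enum|].
elim: (enum I) => [|j s IHs]; first by exists (Imp Bot Bot) => e; split=> //=.
apply: zdef_ext (zdef_and (hX j) IHs) => e; split=> [[Xj Xs] i|H].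
  by rewrite inE => /orP[/eqP ->|/Xs].
by split=> [|i si]; apply: H; rewrite inE ?eqxx ?si ?orbT.
Qed.

Lemma zdef_Pset l n (t : l.-tuple M -> n.-tuple M) :
  projection t -> zdef (fun e => tuple_in (@Pset L M) (t e)).
Proof.
move=> ht; apply: zdef_all => i.
by apply: zdef_ext (zdef_sat (InP L i) ht) => e; rewrite sat_InP.
Qed.

Lemma zdef_definable (A : set M) n m (Y : (n + m).-tuple M -> Prop)
    (b : m.-tuple M) :
  zdef Y -> tuple_in A b -> definable A [set x | Y (cat_tuple x b)].
Proof.
move=> [p pY] Ab; exists m, p, b; split=> //.
by apply/seteqP; split=> x /=; rewrite pY.
Qed.

Lemma zdef_definable0 n (Y : n.-tuple M -> Prop) :
  zdef Y -> definable set0 [set x | Y x].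
Proof.
move=> [p pY].
(* The types for lengths [n + 0] and [n] are not convertible; [lproj] passes from one to the
   other. *)
have : zdef (fun e : (n + 0).-tuple M => sat p (lproj e)).
  by apply: zdef_sat; apply: projection_l; apply: projection_id.
move=> /(@zdef_definable set0 n 0 _ [tuple]).
rewrite (_ : [set x | Y x] = [set x | sat p (lproj (cat_tuple x [tuple]))]).
  by apply; case.
by apply/seteqP; split=> x /=; rewrite lproj_cat pY.
Qed.

End ZeroDefinable.

(** By induction on the formula, only [All] needs the test. It is applied to the negated body, as
    [All] is the primitive quantifier: a counterexample in [M] yields one in [B]. *)
Lemma tarski_vaught L (M : structure L) (B : set M) :
  (forall n (phi : formula L n.+1) (b : n.-tuple M), tuple_in B b ->
     (exists a, sat phi (cons_tuple a b)) ->
     exists a, B a /\ sat phi (cons_tuple a b)) ->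
  elementary B.
Proof.
move=> TV n phi; elim: phi => {n} [n r v|n i j|n|n p IHp q IHq|n p IHp] a.
- rewrite /=.
  suff -> : map_tuple (tnth (map_tuple val a)) v =
            map_tuple val (map_tuple (tnth a) v) by [].
  by apply: eq_from_tnth => i; rewrite !tnth_map.
- by rewrite /= !tnth_map; split=> [->|/val_inj].
- by [].
- by rewrite /= IHp IHq.
- split=> H x; last first.
    by apply/IHp; rewrite map_cons_tuple; exact: H.
  apply: contrapT => Nx.
  have [] := TV n (Imp p Bot) (map_tuple val a) (@tuple_in_map_val _ _ _ a).
    by exists x.
  move=> y [By] /=; apply.
  have /IHp := H (exist _ y (mem_set By)).
  by rewrite map_cons_tuple.
Qed.

(** * Complete sets: elementarity of P^A and control of the algebraic closure *)

Section CompleteSets.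
Variables (L : language) (C : structure L).
Implicit Type A : set C.

Lemma tuple_in_Ppart n (x : n.-tuple C) :
  tuple_in (@Pset L C) x -> exists y : n.-tuple (Ppart C), x = map_tuple val y.
Proof. exact: tuple_in_lift. Qed.

Lemma subset_dcl A : A `<=` dcl A.
Proof.
move=> c Ac; exists 1, (Eq L (lshift 1 ord0) (rshift 1 ord0)), [tuple c].
split; first by move=> i; rewrite (ord1 i).
apply/seteqP; split=> x /=; rewrite tnth_lshift tnth_rshift; first by move=> ->.
by move=> xc; rewrite [x]tuple1E xc.
Qed.

Lemma dcl_subset_acl A : dcl A `<=` acl A.
Proof.
by move=> c Ac; exists [set [tuple c]]; split=> //; exact: finite_set1.
Qed.

(** The test is run inside C^P: an existential statement there becomes, after relativization, one
    about a point of P in C with parameters in A, and completeness puts a witness in P^A. *)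
Lemma complete_set_elementary A : complete_set A -> elementary (Ptrace A).
Proof.
move=> cA; apply: tarski_vaught => n phi b Ab [a pa].
have [||x [PAx]] := cA 1 n (relativize phi) (map_tuple val b).
- by move=> i; rewrite tnth_map; exact: Ab.
- exists [tuple val a]; split; first by move=> i; rewrite (ord1 i); exact/set_mem/valP.
  move/sat_relativize: pa; rewrite map_cons_tuple.
  by rewrite (_ : cons_tuple _ _ = cat_tuple [tuple val a] (map_tuple val b)) //; exact: val_inj.
have [Px Ax] := PAx ord0.
move=> h; exists (exist _ (tnth x ord0) (mem_set Px)); split=> //.
apply/sat_relativize; rewrite map_cons_tuple /=.
rewrite (_ : cons_tuple _ _ = cat_tuple x (map_tuple val b)) //.
by rewrite {2}[x]tuple1E; exact: val_inj.
Qed.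

Lemma complete_set_acl A : complete_set A -> acl A `&` @Pset L C `<=` A.
Proof.
move=> cA c [[X [[m [phi [b [Ab XE]]]] finX Xc]] Pc].
apply: contrapT => NAc.
(* [S] gathers all points of [X] lying in A, whether or not in P; they are all admissible
   parameters. *)
pose S := X `&` [set x | A (tnth x ord0)].
have [k [d' Sd]] := finite_set_tuple (finite_setIl _ finX : finite_set S).
pose d : k.-tuple C := map_tuple (fun x => tnth x ord0) d'.
(* The coordinates of [e] are x, then [b], then [d]. The condition says that x satisfies [phi] over
   [b] and differs from every entry of [d]; if c is not in A, it holds of c. *)
pose Y (e : (1 + (m + k)).-tuple C) :=
  sat phi (cat_tuple (lproj e) (lproj (rproj e))) /\
  forall i, ~ tnth (lproj e) ord0 = tnth (rproj (rproj e)) i.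
have [psi psiY] : zdef Y.
  have hid l := projection_id C l.
  apply: zdef_and.
    apply: zdef_sat; apply: projection_cat; first exact: projection_l.
    exact/projection_l/projection_r.
  apply: zdef_all => i; apply: zdef_not; apply: zdef_eq.
    exact: projection_l.
  exact/projection_r/projection_r.
have Ad : tuple_in A d.
  by move=> i; rewrite tnth_map; have [] : S (tnth d' i) by apply/Sd; exists i.
have [||x [PAx]] := cA _ _ psi (cat_tuple b d).
- exact: tuple_in_cat.
- exists [tuple c]; split; first by move=> i; rewrite (ord1 i).
  apply/psiY; rewrite /Y !lproj_cat !rproj_cat; rewrite !lproj_cat.
  split=> [|i ci]; first by move: Xc; rewrite XE.
  by apply: NAc; rewrite (_ : c = tnth d i) //; exact: Ad.
move/psiY; rewrite /Y !lproj_cat !rproj_cat !lproj_cat => -[px Nx].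
(* The witness given by completeness is in [X] and in A, hence is an entry of [d], which [psi]
   excludes. *)
have /Sd[i xi] : S x by split; [rewrite XE|case: (PAx ord0)].
by apply: (Nx i); rewrite tnth_map xi.
Qed.

(** * From definable closure back to completeness, through codes in C^P *)

Hypotheses (P_embedded : P_stably_embedded C) (P_induced : P_zero_definable C).

(** Stable embeddedness moves the parameters into P, leaving a formula [theta]. The trace of [theta]
    on P is 0-definable in C, hence 0-definable in C^P by some [chi], into which the parameters are
    put back. *)
Lemma definable_Ppart n (X : set (n.-tuple C)) :
  X `<=` tuple_in (@Pset L C) (n := n) -> definable setT X ->
  definable setT [set y : n.-tuple (Ppart C) | X (map_tuple val y)].
Proof.
move=> XP /(P_embedded XP)[m [theta [d [/tuple_in_Ppart[d' ->] XE]]]].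
(* The set is cut down to P in all [n + m] coordinates, parameters included, as [P_induced] concerns
   subsets of powers of P. *)
have [] := @P_induced (n + m) [set z | tuple_in (@Pset L C) z /\ sat theta z].
- by move=> z [].
- apply: zdef_definable0; apply: zdef_and.
    exact/zdef_Pset/projection_id.
  exact/zdef_sat/projection_id.
move=> l [chi [b [_ E]]].
have hid := projection_id (Ppart C) (n + (m + l)).
have hYd : zdef (fun e : (n + (m + l)).-tuple (Ppart C) =>
    sat chi (cat_tuple (cat_tuple (lproj e) (lproj (rproj e))) (rproj (rproj e)))).
  apply: zdef_sat; apply: projection_cat; last exact/projection_r/projection_r.
  apply: projection_cat; first exact: projection_l.
  exact/projection_l/projection_r.
have := @zdef_definable _ _ setT _ _ _ (cat_tuple d' b) hYd.
set Z := (X in definable _ X); set Z' := (X in _ -> definable _ X).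
suff -> : Z = Z' by apply.
apply/seteqP; rewrite /Z /Z'.
have H (y : n.-tuple (Ppart C)) :
    sat chi (cat_tuple (cat_tuple y d') b) <-> X (map_tuple val y).
  have /(congr1 (fun F => F (cat_tuple y d'))) /= := E.
  rewrite map_cat_tuple XE /= => <-; split=> [[]//|h]; split=> //.
  by apply: tuple_in_cat; exact: tuple_in_map_val.
by split=> y /=; rewrite !lproj_cat !rproj_cat !lproj_cat H.
Qed.

Lemma dcl_complete_set A : eliminates_imaginaries (Ppart C) ->
  elementary (Ptrace A) -> dcl A `&` @Pset L C `<=` A -> complete_set A.
Proof.
move=> EI elA dA n m psi b Ab [x0 [Px0 psix0]].
have [y0 y0E] := tuple_in_Ppart Px0.
pose X := [set x | tuple_in (@Pset L C) x /\ sat psi (cat_tuple x b)].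
have [|k [phi [c phic]]] := EI n [set y : n.-tuple (Ppart C) | X (map_tuple val y)].
  apply: definable_Ppart; first by move=> x [].
  have : zdef (fun e => tuple_in (@Pset L C) (lproj e) /\ sat psi e).
    apply: zdef_and; first exact/zdef_Pset/projection_l/projection_id.
    exact/zdef_sat/projection_id.
  move=> /(@zdef_definable _ _ setT _ _ _ b).
  rewrite (_ : [set x | _] = X); first by apply.
  by apply/seteqP; split=> x /=; rewrite lproj_cat.
have XE (y : n.-tuple (Ppart C)) : X (map_tuple val y) <-> sat phi (cat_tuple y c).
  have /(congr1 (fun F => F y)) /= := (phic c).2 erefl.
  by move=> <-.
(* Uniqueness of the code, read in C: a tuple of P through which the relativized [phi] defines
   psi(P,b) must be [c]. *)
have code c' : tuple_in (@Pset L C) c' ->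
    (forall x, tuple_in (@Pset L C) x ->
       (sat psi (cat_tuple x b) <-> sat (relativize phi) (cat_tuple x c'))) ->
    c' = map_tuple val c.
  move=> /tuple_in_Ppart[c'' ->] H; congr map_tuple.
  apply/phic/seteqP; split=> y /=.
    move=> [Py /(H _ Py)]; rewrite -map_cat_tuple.
    exact: (sat_relativize phi _).1.
  move=> h; have Py := tuple_in_map_val y; split=> //; apply/(H _ Py).
  by rewrite -map_cat_tuple; exact: (sat_relativize phi _).2.
have Ac : tuple_in (Ptrace A) c.
  move=> i; apply: dA; split; last exact/set_mem/valP.
  (* With e = (z, b), this says that z is the [i]-th entry of some tuple of P coding psi(P,b). Only
     [b] occurs as a parameter, and [code] leaves the [i]-th entry of [c] as the sole solution, so
     that entry is in dcl(A). *)
  pose Y (e : (1 + m).-tuple C) := exists c' : k.-tuple C,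
    (tuple_in (@Pset L C) c' /\
    (forall x : n.-tuple C, tuple_in (@Pset L C) x ->
       (sat psi (cat_tuple x (rproj e)) <->
        sat (relativize phi) (cat_tuple x c')))) /\
    tnth c' i = tnth (lproj e) ord0.
  have : zdef Y.
    have hid l := projection_id C l.
    apply: zdef_exists; apply: zdef_and; last first.
      by apply: zdef_eq; [exact: projection_l|exact/projection_l/projection_r].
    apply: zdef_and; first exact/zdef_Pset/projection_l.
    (* Inside both quantifiers the coordinates are x, c', z, b in this order, which dictates the
       projections below. *)
    apply: (zdef_forall (X := fun x e => tuple_in (@Pset L C) x -> _)).
    apply: zdef_imp; first exact/zdef_Pset/projection_l.
    apply: zdef_iff; apply: zdef_sat; apply: projection_cat;
      do ?[exact: projection_l].
      exact/projection_r/projection_r/projection_r.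
    exact/projection_l/projection_r.
  move=> /(@zdef_definable _ _ A _ _ _ b)/(_ Ab).
  rewrite /dcl (_ : [set x | _] = [set [tuple val (tnth c i)]]) //.
  apply/seteqP; split=> z; rewrite /Y /= lproj_cat rproj_cat.
    by move=> [c' [[Pc' /(code _ Pc') ->]]]; rewrite tnth_map [z]tuple1E => ->.
  move=> ->; exists (map_tuple val c); split; last by rewrite tnth_map.
  split=> [|x /tuple_in_Ppart[y ->]]; first exact: tuple_in_map_val.
  rewrite -map_cat_tuple sat_relativize -XE.
  by split=> [h|[]//]; split=> //; exact: tuple_in_map_val.
have [c1 c1E] : exists c1 : k.-tuple (substructure (Ptrace A)), c = map_tuple val c1.
  exact: tuple_in_lift Ac.
have [a pa] : exists a : n.-tuple (substructure (Ptrace A)),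
    sat phi (cat_tuple a c1).
  apply: contrapT => /forallNP Na.
  (* If [phi] had no solution over [c1] in P^A, elementarity would carry this universal statement up
     to C^P, where [y0] refutes it. *)
  have /elA : sat (Alls (Imp phi Bot)) c1 by apply/sat_Alls => a; exact: Na.
  rewrite -c1E => /sat_Alls/(_ y0); apply; apply/XE.
  by rewrite -y0E.
move/elA: pa; rewrite map_cat_tuple -c1E => /XE[Pa psia].
exists (map_tuple val (map_tuple val a)); split=> // i; split; first exact: Pa.
by rewrite tnth_map; exact: (tuple_in_map_val a i).
Qed.

End CompleteSets.

Unset Implicit Arguments.

Theorem theorem4p9 (L : language) (T : theory L) (K : Type) (C : structure L)
    (T_complete : complete_theory T)
    (T_P_infinite : implies_P_infinite T)
    (C_monster : monster_model K T C)
    (P_embedded : P_stably_embedded C)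
    (P_induced : P_zero_definable C)
    (T_QE : quantifier_elimination T)
    (TP_EI : eliminates_imaginaries (Ppart C))
    (A : set C) :
  (complete_set A <->
     elementary (Ptrace A) /\ dcl A `&` @Pset L C = A `&` @Pset L C) /\
  (complete_set A <->
     elementary (Ptrace A) /\ acl A `&` @Pset L C = A `&` @Pset L C).
Proof.
have sub_acl : A `<=` acl A by move=> c /subset_dcl/dcl_subset_acl.
have acl_eq : complete_set A -> acl A `&` @Pset L C = A `&` @Pset L C.
  move=> cA; apply/seteqP; split=> c [Ac Pc]; split=> //; last exact: sub_acl.
  exact: (complete_set_acl cA).
(* As dcl(A) lies between A and acl(A), the condition on acl forces the one on dcl. *)
have dcl_eq : acl A `&` @Pset L C = A `&` @Pset L C ->
    dcl A `&` @Pset L C = A `&` @Pset L C.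
  move=> aclE; apply/seteqP; split=> c [Ac Pc]; last by split=> //; exact: subset_dcl.
  by rewrite -aclE; split=> //; exact: dcl_subset_acl.
have complete_of_dcl : elementary (Ptrace A) ->
    dcl A `&` @Pset L C = A `&` @Pset L C -> complete_set A.
  by move=> elA dclE; apply: dcl_complete_set => //; rewrite dclE; exact: subIsetl.
(* Both equivalences follow from the cycle (i) to (iii) to (ii) to (i). *)
split; split.
- by move=> cA; split; [exact: complete_set_elementary|exact/dcl_eq/acl_eq].
- by case; exact: complete_of_dcl.
- by move=> cA; split; [exact: complete_set_elementary|exact: acl_eq].
- by move=> [elA /dcl_eq]; exact: complete_of_dcl.
Qed.
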